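(* Let $\rho_{\rm def}$ be the joint spectral radius of the augmented family $\mathcal D_{\rm def}=\{D_\mu:\mu\text{ a stochastic stationary policy}\}$ of linear maps on $\mathbb R\times\operatorname{span}(\mathbf 1)^\perp$, and let $\bar\rho$ be the projected joint spectral radius. Then \[ \rho_{\rm def}=\bar\rho . \] Consequently, the trajectories of deflated Q-value iteration have exponential convergence rate no larger than $\bar\rho$, in the following sense: for every $\varepsilon\in(0,1-\bar\rho)$, with $\beta_\varepsilon:=\bar\rho+\varepsilon$, there exists $C_{\beta_\varepsilon}>0$ such that every sequence $(Q_k)_{k\ge0}$ generated by deflated Q-value iteration satisfies $\|Q_k-Q^\star\|_2\le C_{\beta_\varepsilon}\beta_\varepsilon^{k-1}\|\boldsymbol{\Pi}_\perp(Q_0-Q^\star)\|_2$ for all $k\ge1$, and hence $\limsup_{k\to\infty}\|Q_k-Q^\star\|_2^{1/k}\le\bar\rho$. Moreover $\bar\rho\le\gamma$, so $\rho_{\rm def}\le\gamma$ (where $\gamma$ is the worst-case full-error rate of standard Q-value iteration $Q_{k+1}=F(Q_k)$); and if $\bar\rho<\gamma$, then $\rho_{\rm def}<\gamma$.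
   Context: Setting: a finite discounted Markov decision process with finite nonempty state space $\mathcal S$, finite nonempty action space $\mathcal A$, transition probabilities $P(s'\mid s,a)$, real rewards $r(s,a,s')$, discount factor $\gamma\in(0,1)$, and expected reward $R(s,a):=\sum_{s'}P(s'\mid s,a)r(s,a,s')$. Put $n:=|\mathcal S||\mathcal A|$; vectors in $\mathbb R^n$ are indexed by pairs $(s,a)$. The Bellman optimality operator $F:\mathbb R^n\to\mathbb R^n$ is $(FQ)(s,a):=R(s,a)+\gamma\sum_{s'}P(s'\mid s,a)\max_{a'}Q(s',a')$, and $Q^\star$ is its unique fixed point (the optimal Q-function). $\mathbf 1$ is the all-ones vector, $\operatorname{span}(\mathbf 1)^\perp=\{x\in\mathbb R^n:\mathbf 1^\top x=0\}$, and $\boldsymbol{\Pi}_\perp:=I-\frac1n\mathbf 1\mathbf 1^\top$. Deflated Q-value iteration is, from an arbitrary $Q_0\in\mathbb R^n$, \[ Q_{k+1}=F(Q_k)+\frac{\gamma}{1-\gamma}\Big(\frac1n\mathbf 1^\top(F(Q_k)-Q_k)\Big)\mathbf 1,\qquad k\ge0. \] A stochastic stationary policy is a map $\mu$ assigning to each $s\in\mathcal S$ a probability distribution $\mu(\cdot\mid s)$ on $\mathcal A$; $\Theta$ denotes the set of deterministic policies $\pi:\mathcal S\to\mathcal A$, identified with the one-hot stochastic policies. For a stochastic policy $\mu$, $A_\mu\in\mathbb R^{n\times n}$ is the matrix with entries $A_\mu((s,a),(s',a')):=\gamma P(s'\mid s,a)\,\mu(a'\mid s')$. Set $\bar A_\mu:=\boldsymbol{\Pi}_\perp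 A_\mu\boldsymbol{\Pi}_\perp$, regarded as a linear map on $\operatorname{span}(\mathbf 1)^\perp$, and let $\ell_\mu:=\frac{1}{n(1-\gamma)}\mathbf 1^\top A_\mu$ (a row vector). Define \[ D_\mu:=\begin{bmatrix}0&\ell_\mu\\0&\bar A_\mu\end{bmatrix}, \] a linear map on $\mathbb R\times\operatorname{span}(\mathbf 1)^\perp$. The joint spectral radius of a bounded set $\mathcal H$ of linear maps on a finite-dimensional real space is $\rho(\mathcal H):=\lim_{k\to\infty}\sup_{A_1,\dots,A_k\in\mathcal H}\|A_k\cdots A_1\|^{1/k}$ for any submultiplicative operator norm (the value does not depend on the norm). The projected joint spectral radius is $\bar\rho:=\rho(\{\bar A_\pi:\pi\in\Theta\})$. *)

(* Defs.v *)
From HB Require Import structures.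
From mathcomp Require Import all_boot all_order all_algebra.
From mathcomp Require Import all_classical all_reals all_analysis.

Set Implicit Arguments.
Unset Strict Implicit.
Unset Printing Implicit Defensive.

Import Order.TTheory GRing.Theory Num.Theory.
Import numFieldNormedType.Exports.

Local Open Scope classical_set_scope.
Local Open Scope ring_scope.

Section JointSpectralRadius.
Variables (R : realType) (V : vectType R).

Definition submul_norm (N : 'End(V) -> R) : Prop :=
  [/\ forall f g, N (f + g) <= N f + N g,
      forall (c : R) f, N (c *: f) = `|c| * N f,
      forall f, N f = 0 -> f = 0
    & forall f g, N (f \o g)%VF <= N f * N g].

(* [sup] and [limn] are total operators; for bounded nonempty [H] and
   [submul_norm N] the suprema are finite and the limit exists.  The term
   k = 0 (where k%:R^-1 = 0) does not affect the limit. *)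
Definition jsr (N : 'End(V) -> R) (H : set 'End(V)) : R :=
  limn (fun k : nat =>
    sup [set N (\big[(@comp_lfun R V V V) / \1%VF]_(i < k) f (rev_ord i))
        | f in [set f : 'I_k -> 'End(V) | forall i, H (f i)]] `^ (k%:R^-1)).

End JointSpectralRadius.

(* [state0] and [action0] witness nonemptiness.  [action0] also seeds the
   maximum in [bellman], whose value does not depend on it. *)
Record mdp (R : realType) (S A : finType) := Mdp {
  state0 : S;
  action0 : A;
  trans : S -> A -> S -> R; (* trans s a s' = P(s' | s, a) *)
  reward : S -> A -> S -> R;
  discount : R;
  trans_ge0 : forall s a s', 0 <= trans s a s';
  trans_sum1 : forall s a, \sum_s' trans s a s' = 1;
  discount_gt0 : 0 < discount;
  discount_lt1 : discount < 1
}.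

Section QVectors.
Variables (R : realType) (S A : finType).

Definition qdim : nat := #|{: S * A}|.

Definition qval (Q : 'cV[R]_qdim) (s : S) (a : A) : R := Q (enum_rank (s, a)) 0.

Definition ones : 'cV[R]_qdim := const_mx 1.

Definition mean (x : 'cV[R]_qdim) : R := qdim%:R^-1 * (ones^T *m x) 0 0.

Definition norm2 (x : 'cV[R]_qdim) : R := Num.sqrt (\sum_i x i 0 ^+ 2).

Definition Pi_perp : 'M[R]_qdim := 1%:M - qdim%:R^-1 *: (ones *m ones^T).

Definition span1_perp : {vspace 'cV[R]_qdim} :=
  lker (linfun (mulmx ones^T : 'cV[R]_qdim -> 'cV[R]_1)).

Definition stochastic_policy : set (S -> A -> R) :=
  [set mu | forall s, (forall a, 0 <= mu s a) /\ \sum_a mu s a = 1].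

Definition onehot (pi : S -> A) : S -> A -> R := fun s a => (a == pi s)%:R.

End QVectors.

Section DeflatedQValueIteration.
Variables (R : realType) (S A : finType) (M : mdp R S A).

Local Notation n := (qdim S A).
Local Notation gamma := (discount M).
Local Notation W := (subvs_of (span1_perp R S A)).

Definition expected_reward (s : S) (a : A) : R :=
  \sum_s' trans M s a s' * reward M s a s'.

Definition bellman (Q : 'cV[R]_n) : 'cV[R]_n :=
  \col_i let: (s, a) := enum_val i in
    expected_reward s a +
    gamma * \sum_s' trans M s a s' *
              \big[Num.max/qval Q s' (action0 M)]_a' qval Q s' a'.

(* The Bellman operator is a contraction, so its fixed point exists and is
   unique; the default value 0 is never used. *)
Definition Qstar : 'cV[R]_n := xget 0 [set Q | bellman Q = Q].

Definition qvi (Q : nat -> 'cV[R]_n) : Prop :=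
  forall k, Q k.+1 = bellman (Q k).

Definition deflated_qvi (Q : nat -> 'cV[R]_n) : Prop :=
  forall k, Q k.+1 = bellman (Q k) +
    (gamma / (1 - gamma) * mean (bellman (Q k) - Q k)) *: ones R S A.

Definition error_rate (Q : nat -> 'cV[R]_n) : \bar R :=
  limn_esup (fun k => (norm2 (Q k - Qstar) `^ (k%:R^-1))%:E).

Definition policy_mx (mu : S -> A -> R) : 'M[R]_n :=
  \matrix_(i, j) let: (s, a) := enum_val i in let: (s', a') := enum_val j in
    gamma * trans M s a s' * mu s' a'.

(* The product lands in [span1_perp], on which [vsproj] is the identity. *)
Definition projected_map (mu : S -> A -> R) : 'End(W) :=
  linfun (fun x : W =>
    vsproj (span1_perp R S A)
      (Pi_perp R S A *m policy_mx mu *m Pi_perp R S A *m vsval x)).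

Definition ell (mu : S -> A -> R) : 'rV[R]_n :=
  (n%:R * (1 - gamma))^-1 *: ((ones R S A)^T *m policy_mx mu).

Definition augmented_map (mu : S -> A -> R) : 'End((R^o * W)%type) :=
  linfun (fun z : (R^o * W)%type =>
    ((ell mu *m vsval z.2) 0 0 : R^o, projected_map mu z.2)).

Definition projected_family : set 'End(W) :=
  range (fun pi : S -> A => projected_map (onehot R pi)).

Definition deflated_family : set 'End((R^o * W)%type) :=
  [set augmented_map mu | mu in @stochastic_policy R S A].

End DeflatedQValueIteration.

(* Main.v *)
Require Import Defs.
From HB Require Import structures.
From mathcomp Require Import all_boot all_order all_algebra.
From mathcomp Require Import all_classical all_reals all_analysis.
From mathcomp Require Import ring lra.

Set Implicit Arguments.
Unset Strict Implicit.
Unset Printing Implicit Defensive.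

Import Order.TTheory GRing.Theory Num.Theory.
Import numFieldNormedType.Exports.

Local Open Scope classical_set_scope.
Local Open Scope ring_scope.

(** Two facts make the theorem true.

    The first concerns trajectories.  The Bellman operator is nonlinear, but
    the difference of its values at two points is a policy matrix [A_mu],
    for some stochastic policy [mu], applied to the difference of the points
    ([bellman_sub]).  Policy matrices satisfy [A_mu 1 = gamma 1], so the mean
    of the error evolves by a scalar rule whose contribution the deflation term
    cancels exactly ([deflated_error]).  Only the mean-zero part of the error
    is propagated, by the projected operators, and the whole error at time
    [k + 1] is a linear function of the mean-zero error at time [k].

    The second concerns radii.  The augmented operators are block triangular
    with a zero first column, so a product of [k + 1] of them is determined
    linearly by a product of [k] projected ones, and contains a product of
    [k + 1] projected ones as a block.  Stochastic policies add nothing, since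
    they are convex combinations of deterministic ones ([policy_mx_convex]) and
    a seminorm of a product is convex in each factor ([words_convex]).

    To turn linear dependence into inequalities for arbitrary submultiplicative
    norms, [seminorm_le_submul_norm] bounds any seminorm on operators by a
    multiple of such a norm.  Thus the suprema defining the two joint spectral
    radii, and the errors of trajectories, agree up to constants and a shift of
    one in the length of products; [growth_rate] is the form of the exponential
    rate in which such changes are harmless, and Fekete's argument
    ([submultiplicative_growth]) shows that the radii are rates in that sense.

    The bound by [gamma] holds because a product of projected operators is the
    compression of a product of policy matrices, which is [gamma ^+ k] times a
    stochastic matrix.  For the undeflated iteration the rate [gamma] is reached
    by an initial error equal to the all-ones vector. *)

(** * Exponential growth rates of real sequences *)

Section GrowthRate.
Variable R : realType.
Implicit Types (u : nat -> R) (rho beta C : R).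

(** A two-sided form of [u k `^ (1 / k)] tending to [rho].  Unlike the limit
    itself it is visibly stable under multiplying [u] by constants and under
    shifting its index, which is how the two families are compared. *)
Definition growth_rate u rho : Prop :=
  [/\ 0 <= rho,
      exists2 c, 0 < c & forall k, (0 < k)%N -> c * rho ^+ k <= u k
    & forall beta, rho < beta ->
        exists2 C, 0 < C & forall k, u k <= C * beta ^+ k].

Lemma root_exprK (x : R) k : (0 < k)%N -> 0 <= x -> (x ^+ k) `^ k%:R^-1 = x.
Proof.
move=> k0 x0; rewrite -powR_mulrn // -powRrM mulfV ?powRr1 //.
by rewrite pnatr_eq0 -lt0n.
Qed.

Lemma expr_rootK (x : R) k : (0 < k)%N -> 0 <= x -> (x `^ k%:R^-1) ^+ k = x.
Proof.
move=> k0 x0; rewrite -powR_mulrn ?powR_ge0 // -powRrM mulVf ?powRr1 //.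
by rewrite pnatr_eq0 -lt0n.
Qed.

(** The constant is absorbed since [C `^ (1 / k) = expR (ln C / k)] tends
    to 1. *)
Lemma cvg_root_geometric C beta : 0 < C -> 0 <= beta ->
  (C * beta ^+ k) `^ k%:R^-1 @[k --> \oo] --> beta.
Proof.
move=> C0 b0.
have invn : (k%:R^-1 : R) @[k --> \oo] --> (0 : R).
  by rewrite -cvg_shiftS; exact: cvg_harmonic.
have Cn : C `^ k%:R^-1 @[k --> \oo] --> (1 : R).
  have -> : (fun k => C `^ k%:R^-1) = (fun k : nat => expR (k%:R^-1 * ln C)).
    by apply/funext => k; rewrite /powR gt_eqF.
  rewrite -[X in _ --> X](@expR0 R) -[X in _ --> expR X](mul0r (ln C)).
  apply: continuous_cvg; first exact: continuous_expR.
  exact: cvgMr_tmp invn.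
rewrite -[X in _ --> X]mul1r.
have Cb : C `^ k%:R^-1 * beta @[k --> \oo] --> 1 * beta by exact: cvgMr_tmp.
apply: cvg_trans Cb.
apply: near_eq_cvg; near=> k.
have k0 : (0 < k)%N by near: k; exists 1%N.
by rewrite powRM ?(ltW C0) ?exprn_ge0 // root_exprK.
Unshelve. all: by end_near. Qed.

Lemma growth_rate_cvg u rho :
  growth_rate u rho -> u k `^ k%:R^-1 @[k --> \oo] --> rho.
Proof.
move=> [rho0 [c c0 lo] up]; apply/cvgrPdist_le => e e0.
have e2 : 0 < e / 2 by rewrite divr_gt0.
have [C C0 hi] := up (rho + e / 2) ltac:(by rewrite ltrDl).
have beta0 : 0 <= rho + e / 2 by rewrite addr_ge0 // ltW.
have /cvgrPdist_le /(_ _ e2) lo' := cvg_root_geometric c0 rho0.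
have /cvgrPdist_le /(_ _ e2) hi' := cvg_root_geometric C0 beta0.
near=> k.
have k0 : (0 < k)%N by near: k; exists 1%N.
have ck : 0 <= c * rho ^+ k by rewrite mulr_ge0 ?exprn_ge0 // ltW.
have k1 : 0 <= k%:R^-1 :> R by rewrite invr_ge0.
have L := ge0_ler_powR k1 _ _ (lo k k0).
have U := ge0_ler_powR k1 _ _ (hi k).
have uk0 : 0 <= u k by apply: le_trans (lo k k0).
have {}L := L ck uk0.
have {}U := U uk0 (le_trans uk0 (hi k)).
have : `|rho - (c * rho ^+ k) `^ k%:R^-1| <= e / 2 by near: k.
have : `|rho + e / 2 - (C * (rho + e / 2) ^+ k) `^ k%:R^-1| <= e / 2.
  by near: k.
rewrite !ler_norml => /andP[A1 A2] /andP[B1 B2].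
by apply/andP; split; lra.
Unshelve. all: by end_near. Qed.

(** Fekete's argument.  The rate is the infimum of the roots
    [u k `^ (1 / k)]; if [u m <= beta ^+ m] for one [m], Euclidean division of
    [k] by [m] bounds every [u k], the finitely many remainders being paid by
    the constant. *)
Lemma submultiplicative_growth u :
  (forall k, 0 <= u k) -> (forall m n, u (m + n)%N <= u m * u n) ->
  exists rho, growth_rate u rho.
Proof.
move=> u0 uD; set E := [set u k `^ k%:R^-1 | k in [set k | (0 < k)%N]].
have E0 : lbound E 0 by move=> _ [k _ <-]; exact: powR_ge0.
have hE : has_inf E.
  by split; [exists (u 1%N `^ 1%:R^-1), 1%N | exists 0].
have rho0 : 0 <= inf E by apply: lb_le_inf => //; case: hE.
exists (inf E); split => //.
  exists 1 => // k k0; rewrite mul1r -[leRHS](expr_rootK k0 (u0 k)).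
  rewrite lerXn2r ?nnegrE ?powR_ge0 //.
  by apply: ge_inf; [case: hE | exists k].
move=> beta rb.
have [_ [m m0 <-] um] := inf_lt (proj1 hE) rb.
have b0 : 0 < beta by apply: le_lt_trans rb.
have umb : u m <= beta ^+ m.
  rewrite -[leLHS](expr_rootK m0 (u0 m)) lerXn2r ?nnegrE ?powR_ge0 //.
    exact: ltW.
  exact: ltW.
have uq q r : u (q * m + r)%N <= (beta ^+ m) ^+ q * u r.
  elim: q => [|q IH]; first by rewrite mul0n add0n expr0 mul1r.
  rewrite mulSn -addnA; apply: le_trans (uD _ _) _.
  by rewrite exprS -mulrA; apply: ler_pM => //; exact: u0.
pose C := 1 + \sum_(r < m) u r / beta ^+ r.
have t0 (r : 'I_m) : 0 <= u r / beta ^+ r.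
  by rewrite divr_ge0 // exprn_ge0 // ltW.
exists C; first by rewrite ltr_pwDl // sumr_ge0.
move=> k; rewrite {1}(divn_eq k m); apply: le_trans (uq _ _) _.
rewrite {3}(divn_eq k m) exprD mulnC exprM mulrCA.
apply: ler_wpM2l; first by rewrite !exprn_ge0 // ltW.
rewrite -ler_pdivrMr ?exprn_gt0 //.
have rm : (k %% m < m)%N by rewrite ltn_mod.
rewrite /C (bigD1 (Ordinal rm)) //= addrCA lerDl addr_ge0 //.
by apply: sumr_ge0.
Qed.

Lemma limn_esup_root_le u C beta : 0 <= beta ->
  (forall k, 0 <= u k) ->
  (forall k, (0 < k)%N -> u k <= C * beta ^+ k) ->
  (limn_esup (fun k => (u k `^ k%:R^-1)%:E) <= beta%:E)%E.
Proof.
move=> b0 u0 uC; apply/lee_addgt0Pr => e e0.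
have C1 : 0 < `|C| + 1 by rewrite ltr_wpDl.
have /cvgrPdist_le /(_ _ e0) [K _ HK] := cvg_root_geometric C1 b0.
apply: (@le_trans _ _
  (ereal_sup ((fun k => (u k `^ k%:R^-1)%:E) @` [set k | (maxn K 1 <= k)%N]))).
  by apply: ereal_inf_lbound; exists [set k | (maxn K 1 <= k)%N] => //;
     exists (maxn K 1).
apply: ge_ereal_sup => _ [k + <-]; rewrite /= geq_max => /andP[Kk k0].
rewrite lee_fin.
have uk : u k <= (`|C| + 1) * beta ^+ k.
  apply: le_trans (uC k k0) _; apply: ler_wpM2r; first exact: exprn_ge0.
  by rewrite (le_trans (ler_norm C)) // lerDl.
have k1 : 0 <= k%:R^-1 :> R by rewrite invr_ge0.
apply: le_trans (ge0_ler_powR k1 _ _ uk) _; rewrite ?nnegrE //.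
  exact: le_trans uk.
by have := HK k Kk; rewrite /= ler_norml => /andP[]; lra.
Qed.

End GrowthRate.

(** * Seminorms and convex combinations *)

Section Seminorms.
Variables (R : realType) (V : lmodType R).
Implicit Types (phi : V -> R).

(** Seminorms rather than norms, so that the size of any linear image of an
    operator, such as one of its blocks, qualifies. *)
Definition seminorm phi : Prop :=
  (forall x y, phi (x + y) <= phi x + phi y) /\
  (forall c x, phi (c *: x) = `|c| * phi x).

Lemma seminorm0 phi : seminorm phi -> phi 0 = 0.
Proof. by case=> _ h; rewrite -(scale0r 0) h normr0 mul0r. Qed.

Lemma seminorm_ge0 phi x : seminorm phi -> 0 <= phi x.
Proof.
move=> sphi; have [hD hZ] := sphi.
have := hD x (-1 *: x); rewrite hZ normrN1 mul1r scaleN1r subrr seminorm0 //.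
by move=> ?; lra.
Qed.

Lemma seminorm_sum phi I (r : seq I) (F : I -> V) : seminorm phi ->
  phi (\sum_(i <- r) F i) <= \sum_(i <- r) phi (F i).
Proof.
move=> sphi; elim: r => [|i r IH]; first by rewrite !big_nil seminorm0.
rewrite !big_cons; case: sphi => hD _.
by apply: le_trans (hD _ _) _; rewrite lerD2l.
Qed.

Definition convex_comb_of (H0 : set V) (f : V) : Prop :=
  exists (I : finType) (w : I -> R) (g : I -> V),
    [/\ forall i, 0 <= w i, \sum_i w i = 1, forall i, H0 (g i)
      & f = \sum_i w i *: g i].

Lemma seminorm_convex_comb phi (H0 : set V) f B : seminorm phi ->
  (forall g, H0 g -> phi g <= B) -> convex_comb_of H0 f -> phi f <= B.
Proof.
move=> sphi hB [I [w [g [w0 w1 gH ->]]]].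
apply: le_trans (seminorm_sum _ _ sphi) _.
rewrite -[leRHS]mul1r -w1 mulr_suml; apply: ler_sum => i _.
by case: sphi => _ ->; rewrite ger0_norm // ler_wpM2l // hB.
Qed.

End Seminorms.

(** Lets [linfun] be evaluated on anonymous functions, on which no linear
    structure can be inferred. *)
Lemma linfun_lamE (R : nzRingType) (aT rT : vectType R) (f : aT -> rT) :
  linear f -> linfun f =1 f.
Proof.
move=> lf; pose fL : {linear aT -> rT} :=
  HB.pack f (GRing.isLinear.Build _ _ _ _ f lf).
by move=> x; rewrite -[f]/(fL : _ -> _) lfunE.
Qed.

(** * Submultiplicative norms dominate all seminorms *)

Section SubmultiplicativeNorms.
Variables (R : realType) (V : vectType R).
Variables (N : 'End(V) -> R) (hN : submul_norm N).

Lemma submul_norm_seminorm : seminorm N.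
Proof. by case: hN. Qed.

(** The matrix units [E_ij] of the basis [vbasis {:V}]. *)
Definition elem_lfun (i j : 'I_(\dim {:V})) : 'End(V) :=
  linfun (fun x : V => coord (vbasis {:V}) j x *: (vbasis {:V})`_i).

Lemma elem_lfunE i j x :
  elem_lfun i j x = coord (vbasis {:V}) j x *: (vbasis {:V})`_i.
Proof.
by apply: linfun_lamE => a u v; rewrite linearD linearZ scalerDl scalerA.
Qed.

Lemma coord_elem (i j : 'I_(\dim {:V})) :
  coord (vbasis {:V}) i (vbasis {:V})`_j = (i == j)%:R.
Proof. by rewrite coord_free ?(basis_free (vbasisP _)) // eq_sym. Qed.

Definition lfun_coef (f : 'End(V)) (i j : 'I_(\dim {:V})) : R :=
  coord (vbasis {:V}) i (f (vbasis {:V})`_j).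

(** The identity [E_ii f E_jj = f_ij E_ij], which gives a submultiplicative
    norm control over each coefficient of [f]. *)
Lemma elem_lfun_comp (f : 'End(V)) i j :
  (elem_lfun i i \o (f \o elem_lfun j j))%VF = lfun_coef f i j *: elem_lfun i j.
Proof.
apply/lfunP => x; rewrite scale_lfunE !comp_lfunE !elem_lfunE !linearZ /=.
by rewrite scalerA mulrC.
Qed.

Lemma lfun_sum_elem (f : 'End(V)) :
  f = \sum_i \sum_j lfun_coef f i j *: elem_lfun i j.
Proof.
apply/lfunP => x; rewrite sum_lfunE.
rewrite {1}(coord_vbasis (memvf x))  linear_sum.
under [RHS]eq_bigr => i _ do rewrite sum_lfunE.
rewrite [RHS]exchange_big /=; apply: eq_bigr => j _.
rewrite linearZ /= {1}(coord_vbasis (memvf (f _))) scaler_sumr.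
apply: eq_bigr => i _; rewrite scale_lfunE elem_lfunE /lfun_coef.
by rewrite !scalerA mulrC.
Qed.

Lemma elem_lfun_neq0 i j : elem_lfun i j != 0.
Proof.
apply/eqP => /lfunP /(_ (vbasis {:V})`_j); rewrite elem_lfunE coord_elem eqxx.
rewrite scale1r zero_lfunE => e0.
by have := coord_elem i i; rewrite e0 linear0 eqxx => /esym/eqP; rewrite oner_eq0.
Qed.

(** Equivalence of norms without compactness: submultiplicativity applied to
    [E_ii f E_jj = f_ij E_ij] yields
    [`|f_ij| * N E_ij <= N E_ii * N E_jj * N f], and [phi f] is at most
    [\sum_ij `|f_ij| * phi E_ij].  All norm comparisons between different
    spaces of operators go through this lemma. *)
Lemma seminorm_le_submul_norm (phi : 'End(V) -> R) : seminorm phi ->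
  exists2 C, 0 < C & forall f, phi f <= C * N f.
Proof.
move=> sphi; have sN := submul_norm_seminorm.
have N0 f := seminorm_ge0 f sN.
have p0 f := seminorm_ge0 f sphi.
have Np i j : 0 < N (elem_lfun i j).
  rewrite lt_def N0 andbT; apply/eqP; case: hN => _ _ Neq _ /Neq /eqP.
  by rewrite (negbTE (elem_lfun_neq0 i j)).
pose K i j := phi (elem_lfun i j) *
  (N (elem_lfun i i) * N (elem_lfun j j) / N (elem_lfun i j)).
have K0 i j : 0 <= K i j by rewrite /K !mulr_ge0 ?invr_ge0.
exists (1 + \sum_i \sum_j K i j).
  by rewrite ltr_pwDl // sumr_ge0 // => i _; rewrite sumr_ge0.
move=> f; rewrite {1}(lfun_sum_elem f).
apply: (@le_trans _ _ (\sum_i \sum_j K i j * N f)); last first.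
  rewrite mulrDl mul1r; under eq_bigr => i _ do rewrite -mulr_suml.
  by rewrite -mulr_suml lerDr.
apply: le_trans (seminorm_sum _ _ sphi) _; apply: ler_sum => i _.
apply: le_trans (seminorm_sum _ _ sphi) _; apply: ler_sum => j _.
case: sphi => _ ->; rewrite /K mulrC -mulrA; apply: ler_wpM2l => //.
rewrite mulrAC ler_pdivlMr //.
case: hN => _ NZ _ NM; rewrite -NZ -elem_lfun_comp.
apply: le_trans (NM _ _) _; rewrite -mulrA; apply: ler_wpM2l => //.
by apply: le_trans (NM _ _) _; rewrite mulrC.
Qed.

End SubmultiplicativeNorms.

(** * Products of operators and the joint spectral radius *)

Section Words.
Variables (R : realType) (V : vectType R).
Implicit Types (H : set 'End(V)) (N : 'End(V) -> R).

(** The products of [k] members of [H], built from the left; the recursive form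
    replaces the indexed product in [jsr] so that induction applies. *)
Fixpoint words H (k : nat) : set 'End(V) :=
  if k is j.+1 then [set (f \o g)%VF | f in H & g in words H j]
  else [set \1%VF].

Lemma words_bigE H k :
  [set \big[(@comp_lfun R V V V) / \1%VF]_(i < k) f (rev_ord i)
    | f in [set f : 'I_k -> 'End(V) | forall i, H (f i)]] = words H k.
Proof.
elim: k => [|k IH]; apply/seteqP; split => [h|h] /=.
- by case=> f _ <-; rewrite big_ord0.
- by move=> ->; exists (fun=> 0); [case | rewrite big_ord0].
- case=> f fH <-; rewrite big_ord_recl; exists (f (rev_ord ord0)) => //.
  eexists; last by reflexivity.
  rewrite -IH; exists (fun i => f (widen_ord (leqnSn k) i)) => //.
  apply: eq_bigr => i _; congr f; apply/val_inj => /=.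
  by rewrite /bump leq0n add1n subSS.
- case=> g gH [h']; rewrite -IH => -[f fH <-] <-.
  exists (fun i => if unlift ord_max i is Some j then f j else g).
    by move=> i; case: unliftP => [j _|_].
  rewrite big_ord_recl; congr (_ \o _)%VF.
    case: unliftP => // j /(congr1 val) /=.
    by rewrite subn1 /bump leqNgt (ltn_ord j) add0n => /eqP; rewrite gtn_eqF.
  apply: eq_bigr => i _; case: unliftP => [j|] /(congr1 val) /=.
    rewrite /bump [(k <= j)%N]leqNgt (ltn_ord j) add0n subSS => ij.
    by congr f; apply/val_inj; rewrite /= -ij.
  rewrite /bump add1n subSS => /eqP; rewrite ltn_eqF //.
  by rewrite -subSn // subSS leq_subr.
Qed.

Definition word_norm N H (k : nat) : R := sup (N @` words H k).

Lemma jsrE N H :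
  jsr N H = limn (fun k => word_norm N H k `^ k%:R^-1).
Proof.
rewrite /jsr; congr (lim (_ @ \oo)); apply/funext => k.
by rewrite /word_norm -words_bigE image_comp.
Qed.

Lemma words_nonempty H k : H !=set0 -> words H k !=set0.
Proof.
move=> [f fH]; elim: k => [|k [g gH]]; first by exists \1%VF.
by exists (f \o g)%VF; exists f => //; exists g.
Qed.

Lemma words_cat H m n h : words H (m + n)%N h ->
  exists f g, [/\ words H m f, words H n g & h = (f \o g)%VF].
Proof.
elim: m h => [|m IH] h /=.
  by move=> hH; exists \1%VF, h; split; rewrite ?comp_lfun1l.
case=> f fH [g /IH[f' [g' [f'H g'H ->]]] <-].
exists (f \o f')%VF, g'; split => //; last by rewrite comp_lfunA.
by exists f => //; exists f'.
Qed.

(** A product is affine in each of its factors, so replacing the factors one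
    at a time by convex combinations cannot increase a seminorm beyond its
    largest value over products of members of [H0].  The induction peels off the
    leftmost factor and passes to the seminorms [f' |-> phi (f' \o g)] and
    [g' |-> phi (f' \o g')]. *)
Lemma words_convex H0 H k phi B : seminorm phi ->
  (forall f, H f -> convex_comb_of H0 f) ->
  (forall g, words H0 k g -> phi g <= B) ->
  forall g, words H k g -> phi g <= B.
Proof.
move=> sphi hH; elim: k phi sphi => [//|k IH] phi sphi hB _ [f fH [g gH <-]].
have sl (h : 'End(V)) : seminorm (fun f' : 'End(V) => phi (f' \o h)%VF).
  case: sphi => hD hZ; split=> [x y|c x]; first by rewrite comp_lfunDl.
  by rewrite -comp_lfunZl hZ.
have sr (h : 'End(V)) : seminorm (fun f' : 'End(V) => phi (h \o f')%VF).
  case: sphi => hD hZ; split=> [x y|c x]; first by rewrite comp_lfunDr.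
  by rewrite -comp_lfunZr hZ.
apply: (seminorm_convex_comb (sl g) _ (hH f fH)) => f' f'H.
apply: (IH _ (sr f')) => // g' g'H; apply: hB.
by exists f' => //; exists g'.
Qed.

Section JointSpectralRadius.
Variables (N : 'End(V) -> R) (hN : submul_norm N) (H : set 'End(V)).
Hypothesis H0 : H !=set0.
Variable (B : R).
Hypothesis HB : forall f, H f -> N f <= B.

Lemma words_bounded k : exists K, forall g, words H k g -> N g <= K.
Proof.
have sN := submul_norm_seminorm hN; have N0 f := seminorm_ge0 f sN.
elim: k => [|k [K hK]]; first by exists (N \1%VF) => g ->.
exists (B * K) => _ [f fH [g gH <-]].
case: hN => _ _ _ NM; apply: le_trans (NM _ _) _.
by apply: ler_pM => //; [exact: HB | exact: hK].
Qed.

Lemma word_norm_ge k g : words H k g -> N g <= word_norm N H k.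
Proof.
move=> gH; apply: ub_le_sup; last by exists g.
by have [K hK] := words_bounded k; exists K => _ [f fH <-]; exact: hK.
Qed.

Lemma word_norm_le k K :
  (forall g, words H k g -> N g <= K) -> word_norm N H k <= K.
Proof.
move=> hK; apply: ge_sup; last by move=> _ [f fH <-]; exact: hK.
by have [g gH] := words_nonempty k H0; exists (N g), g.
Qed.

Lemma word_norm_ge0 k : 0 <= word_norm N H k.
Proof.
have [g gH] := words_nonempty k H0.
exact: le_trans (seminorm_ge0 g (submul_norm_seminorm hN)) (word_norm_ge gH).
Qed.

(** The total operators [sup] and [limn] in [jsr] have their expected meaning
    on a bounded nonempty family, because the suprema are submultiplicative. *)
Lemma jsr_growth_rate : growth_rate (word_norm N H) (jsr N H).
Proof.
have [|m n|rho hrho] := @submultiplicative_growth _ (word_norm N H).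
- exact: word_norm_ge0.
- apply: word_norm_le => _ /words_cat[f [g [fH gH ->]]].
  case: hN => _ _ _ NM; apply: le_trans (NM _ _) _.
  have N0 f' := seminorm_ge0 f' (submul_norm_seminorm hN).
  by apply: ler_pM => //; exact: word_norm_ge.
by rewrite jsrE (cvg_lim _ (growth_rate_cvg hrho)).
Qed.

Lemma growth_rate_jsr rho : growth_rate (word_norm N H) rho -> jsr N H = rho.
Proof. by move=> hrho; rewrite jsrE (cvg_lim _ (growth_rate_cvg hrho)). Qed.

End JointSpectralRadius.
End Words.

(** * Fixed points of sup-norm contractions *)

(** Joins the completeness and the norm of matrices into the structure required
    by the Banach fixed point theorem. *)
HB.instance Definition _ (R : realType) (m n : nat) := Complete.on 'M[R]_(m, n).

Lemma contraction_fixed_point (R : realType) n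
    (T : 'cV[R]_n -> 'cV[R]_n) (q : R) :
  0 <= q -> q < 1 ->
  (forall (x y : 'cV[R]_n) B, (forall i, `|(x - y) i 0| <= B) ->
     forall i, `|(T x - T y) i 0| <= q * B) -> exists p, T p = p.
Proof.
move=> q0 q1 Tq.
have nrm (x : 'cV[R]_n) i : `|x i 0| <= `|x|.
  rewrite [leRHS]mx_normrE.
  exact: (le_bigmax _ (fun ij => `|x ij.1 ij.2|) (i, 0)).
have nrmP (x : 'cV[R]_n) B : 0 <= B -> (forall i, `|x i 0| <= B) -> `|x| <= B.
  move=> B0 xB; rewrite [leLHS]mx_normrE; apply: bigmax_le => // -[i j] _ /=.
  by rewrite ord1.
have Tset : set_fun setT setT T by [].
pose f : {fun [set: 'cV[R]_n] >-> [set: 'cV[R]_n]} :=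
  HB.pack T (isFun.Build _ _ _ _ T Tset).
have cf : is_contraction f.
  exists (NngNum q0); split => //= -[x y] _ /=.
  by apply: nrmP; [rewrite mulr_ge0 | apply: Tq => i; exact: nrm].
have [p _ fp] := banach_fixed_point cf closedT (ex_intro _ 0 I).
by exists p.
Qed.

(** * Splitting a vector into its mean and its mean-zero part *)

Section MeanDecomposition.
Variables (R : realType) (S A : finType).
Hypothesis n_gt0 : (0 < qdim S A)%N.
Local Notation n := (qdim S A).
Local Notation one := (ones R S A).
Local Notation Pi := (Pi_perp R S A).
Local Notation W := (subvs_of (span1_perp R S A)).

Lemma qdim_neq0 : n%:R != 0 :> R.
Proof. by rewrite pnatr_eq0 -lt0n. Qed.

Lemma ones_sqr : one^T *m one = n%:R%:M.
Proof.
apply/matrixP => i j; rewrite !ord1 !mxE eqxx mulr1n.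
under eq_bigr => k _ do rewrite !mxE mulr1.
by rewrite sumr_const card_ord.
Qed.

Lemma ones_mulmx (x : 'cV[R]_n) : one *m (one^T *m x) = (n%:R * mean x) *: one.
Proof.
rewrite [one^T *m x]mx11_scalar mul_mx_scalar /mean mulrA mulfV ?qdim_neq0 //.
by rewrite mul1r.
Qed.

Lemma mean_Pi (x : 'cV[R]_n) : x = mean x *: one + Pi *m x.
Proof.
rewrite /Pi_perp mulmxBl mul1mx -scalemxAl -mulmxA ones_mulmx scalerA mulrA.
by rewrite mulVf ?qdim_neq0 // mul1r addrC subrK.
Qed.

Lemma Pi_ones : Pi *m one = 0.
Proof.
rewrite /Pi_perp mulmxBl mul1mx -scalemxAl -mulmxA ones_sqr mul_mx_scalar.
by rewrite scalerA mulVf ?qdim_neq0 // scale1r subrr.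
Qed.

Lemma mem_span1_perp (x : 'cV[R]_n) :
  (x \in span1_perp R S A) = (one^T *m x == 0).
Proof. by rewrite memv_ker lfunE. Qed.

Lemma Pi_mem (x : 'cV[R]_n) : Pi *m x \in span1_perp R S A.
Proof.
rewrite mem_span1_perp /Pi_perp mulmxA mulmxBr mulmx1 -scalemxAr mulmxA ones_sqr.
by rewrite mul_scalar_mx scalerA mulVf ?qdim_neq0 // scale1r subrr mul0mx.
Qed.

Lemma Pi_id (x : 'cV[R]_n) : x \in span1_perp R S A -> Pi *m x = x.
Proof.
rewrite mem_span1_perp => /eqP x0.
by rewrite /Pi_perp mulmxBl mul1mx -scalemxAl -mulmxA x0 mulmx0 scaler0 subr0.
Qed.

Lemma Pi_vsval (w : W) : Pi *m vsval w = vsval w.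
Proof. exact: Pi_id (subvsP w). Qed.

Lemma vsval_vsproj_Pi (x : 'cV[R]_n) :
  vsval (vsproj (span1_perp R S A) (Pi *m x)) = Pi *m x.
Proof. by rewrite vsprojK // Pi_mem. Qed.

(** The compression of a matrix to the mean-zero space.  For a policy matrix
    this is [projected_map] ([projected_mapE]); as a function of an arbitrary
    matrix it is linear, so convex combinations of policy matrices carry
    over. *)
Definition compress (X : 'M[R]_n) : 'End(W) :=
  linfun (fun w : W => vsproj (span1_perp R S A) (Pi *m (X *m vsval w))).

Lemma compressE X w :
  compress X w = vsproj (span1_perp R S A) (Pi *m (X *m vsval w)).
Proof.
apply: linfun_lamE => a u v.
by rewrite !linearP.
Qed.

Lemma compress_linear : linear compress.
Proof.
move=> a X Y; apply/lfunP => w; rewrite add_lfunE scale_lfunE !compressE.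
by rewrite [(_ + Y) *m _]mulmxDl -scalemxAl !linearP.
Qed.

(** Likewise, with [l] equal to [(n * (1 - gamma))^-1], this is
    [augmented_map] extended linearly to all matrices. *)
Definition augment (l : R) (X : 'M[R]_n) : 'End((R^o * W)%type) :=
  linfun (fun z : (R^o * W)%type =>
    (l * (one^T *m X *m vsval z.2) 0 0 : R^o, compress X z.2)).

Lemma augmentE l X z :
  augment l X z = (l * (one^T *m X *m vsval z.2) 0 0 : R^o, compress X z.2).
Proof.
apply: linfun_lamE => a u v /=; rewrite !linearP /=; congr pair.
by rewrite !mxE mulrDr mulrCA.
Qed.

Lemma augment_linear l : linear (augment l).
Proof.
move=> a X Y; apply/lfunP => z; rewrite add_lfunE scale_lfunE !augmentE.
rewrite compress_linear add_lfunE scale_lfunE; congr pair => /=.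
rewrite  [one^T *m (_ + _)]mulmxDr -scalemxAr mulmxDl -scalemxAl.
by rewrite !mxE mulrDr mulrCA.
Qed.

End MeanDecomposition.

(** * Policy matrices and the Bellman operator *)

Section PolicyMatrices.
Variables (R : realType) (S A : finType) (M : mdp R S A).
Local Notation n := (qdim S A).
Local Notation one := (ones R S A).
Local Notation Pi := (Pi_perp R S A).
Local Notation gamma := (discount M).
Local Notation W := (subvs_of (span1_perp R S A)).

Lemma qdim_gt0 : (0 < n)%N.
Proof. by apply/card_gt0P; exists (state0 M, action0 M). Qed.

Lemma sum_index (F : S -> A -> R) :
  \sum_(j < n) F (enum_val j).1 (enum_val j).2 = \sum_s \sum_a F s a.
Proof.
rewrite pair_bigA /=.
rewrite -(big_enum_val (A := {: S * A}) (fun p : S * A => F p.1 p.2)).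
by apply: eq_bigl => p; rewrite inE.
Qed.

Lemma policy_mxE mu i j : policy_mx M mu i j =
  gamma * trans M (enum_val i).1 (enum_val i).2 (enum_val j).1 *
    mu (enum_val j).1 (enum_val j).2.
Proof. by rewrite mxE; case: (enum_val i) => s a; case: (enum_val j). Qed.

Lemma policy_mx_mulE mu (x : 'cV[R]_n) i : (policy_mx M mu *m x) i 0 =
  gamma * \sum_s' trans M (enum_val i).1 (enum_val i).2 s' *
    \sum_a' mu s' a' * qval x s' a'.
Proof.
pose F s' a' :=
  gamma * trans M (enum_val i).1 (enum_val i).2 s' * mu s' a' * qval x s' a'.
rewrite mxE (eq_bigr (fun j : 'I_n => F (enum_val j).1 (enum_val j).2)).
  rewrite sum_index mulr_sumr; apply: eq_bigr => s' _.
  rewrite mulrA mulr_sumr; by apply: eq_bigr => a' _; rewrite /F -!mulrA.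
by move=> j _; rewrite policy_mxE /F /qval -surjective_pairing enum_valK.
Qed.

Section Stochastic.
Variables (mu : S -> A -> R) (hmu : stochastic_policy mu).

Lemma policy_mx_ge0 i j : 0 <= policy_mx M mu i j.
Proof.
rewrite policy_mxE !mulr_ge0 ?trans_ge0 ?(ltW (discount_gt0 M)) //.
by case: (hmu (enum_val j).1).
Qed.

Lemma policy_mx_ones : policy_mx M mu *m one = gamma *: one.
Proof.
apply/matrixP => i j; rewrite ord1 policy_mx_mulE !mxE mulr1.
rewrite (eq_bigr (trans M (enum_val i).1 (enum_val i).2)) ?trans_sum1 ?mulr1 //.
move=> s _; rewrite (eq_bigr (mu s)); first by case: (hmu s) => _ ->; rewrite mulr1.
by move=> a _; rewrite /qval mxE mulr1.
Qed.

Lemma policy_mx_bound (x : 'cV[R]_n) B : (forall i, `|x i 0| <= B) ->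
  forall i, `|(policy_mx M mu *m x) i 0| <= gamma * B.
Proof.
move=> xB i; rewrite mxE; apply: le_trans (ler_norm_sum _ _ _) _.
have -> : gamma * B = \sum_j policy_mx M mu i j * B.
  rewrite -mulr_suml; congr (_ * B).
  transitivity ((policy_mx M mu *m one) i 0).
    by rewrite policy_mx_ones !mxE mulr1.
  by rewrite mxE; apply: eq_bigr => j _; rewrite [one j 0]mxE mulr1.
apply: ler_sum => j _; rewrite normrM ger0_norm ?policy_mx_ge0 //.
by apply: ler_wpM2l (xB j); exact: policy_mx_ge0.
Qed.

(** The inner projection changes [x] by a multiple of [one], which a policy
    matrix maps to a multiple of [one], which the outer projection kills. *)
Lemma policy_mx_Pi (x : 'cV[R]_n) :
  Pi *m (policy_mx M mu *m (Pi *m x)) = Pi *m (policy_mx M mu *m x).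
Proof.
rewrite [in RHS](mean_Pi qdim_gt0 x) mulmxDr -scalemxAr policy_mx_ones.
by rewrite mulmxDr -!scalemxAr (Pi_ones _ qdim_gt0) !scaler0 add0r.
Qed.

Lemma projected_mapE : projected_map M mu = compress (policy_mx M mu).
Proof.
apply/lfunP => w; rewrite compressE.
rewrite /projected_map linfun_lamE; last by move=> a u v; rewrite !linearP.
by rewrite -!mulmxA Pi_vsval.
Qed.

Lemma augmented_mapE :
  augmented_map M mu = augment (n%:R * (1 - gamma))^-1 (policy_mx M mu).
Proof.
apply/lfunP => z; rewrite augmentE.
rewrite /augmented_map linfun_lamE.
  by rewrite -projected_mapE /ell -scalemxAl mxE.
move=> a u v; rewrite !linearP /=; congr pair.
by rewrite !mxE.
Qed.

End Stochastic.

Lemma onehot_stochastic (pi : S -> A) : stochastic_policy (onehot R pi).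
Proof.
move=> s; split=> [a|]; first by rewrite /onehot ler0n.
rewrite (bigD1 (pi s)) //= big1 ?addr0 /onehot ?eqxx // => a /negbTE ->.
by [].
Qed.

Definition det_mx (pi : {ffun S -> A}) : 'M[R]_n := policy_mx M (onehot R pi).

(** A stochastic policy is the law of a random deterministic one that draws its
    action in every state independently: the weight of [pi] is
    [\prod_s mu s (pi s)], and each marginal of this product law is the
    corresponding [mu s]. *)
Lemma policy_mx_convex mu : stochastic_policy mu ->
  convex_comb_of (range det_mx) (policy_mx M mu).
Proof.
move=> hmu; exists {ffun S -> A}, (fun pi : {ffun _} => \prod_s mu s (pi s)).
exists det_mx.
have marginal (F : S -> A -> R) :
    \sum_(pi : {ffun S -> A}) \prod_s F s (pi s) = \prod_s \sum_a F s a.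
  by rewrite bigA_distr_bigA.
split.
- by move=> pi; apply: prodr_ge0 => s _; case: (hmu s).
- by rewrite marginal big1 // => s _; case: (hmu s).
- by move=> pi; exists pi.
apply/matrixP => i j; rewrite summxE policy_mxE.
set c := gamma * _; set s := (enum_val j).1; set a := (enum_val j).2.
under eq_bigr => pi _ do rewrite mxE policy_mxE -/c mulrCA.
rewrite -mulr_sumr; congr (_ * _); rewrite -/s -/a /onehot.
(* [F] inserts the event [pi s = a] into the product as a factor at [s], so
   that the marginal at [s] becomes an instance of [marginal]. *)
pose F t b := mu t b * (if t == s then (a == b)%:R else 1).
rewrite (eq_bigr (fun pi : {ffun S -> A} => \prod_t F t (pi t))); last first.
  move=> pi _; rewrite /F big_split /=; congr (_ * _).
  by rewrite -big_mkcond /= big_pred1_eq.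
rewrite marginal (bigD1 s) //= [X in _ * X]big1 ?mulr1.
  rewrite (bigD1 a) //= big1 ?addr0 /F ?eqxx ?mulr1 // => b /negbTE ba.
  by rewrite eq_sym ba mulr0.
move=> t /negbTE ts; rewrite /F ts; under eq_bigr => b _ do rewrite mulr1.
by case: (hmu t).
Qed.

Lemma projected_familyE :
  projected_family M = (@compress R S A \o det_mx) @` setT.
Proof.
apply/seteqP; split => [_ [pi _ <-]|_ [pi _ <-]].
  exists [ffun s => pi s] => //=; rewrite projected_mapE /det_mx.
  congr (compress (policy_mx _ (onehot _ _))).
  by apply/funext => s; rewrite ffunE.
by exists pi => //; rewrite projected_mapE.
Qed.

Lemma deflated_familyE : deflated_family M =
  [set augment (n%:R * (1 - gamma))^-1 (policy_mx M mu)
    | mu in @stochastic_policy R S A].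
Proof.
by apply/seteqP; split => [_ [mu hmu <-]|_ [mu hmu <-]]; exists mu => //;
   rewrite augmented_mapE.
Qed.

Lemma max_attained (Q : 'cV[R]_n) s :
  exists2 a, \big[Num.max/qval Q s (action0 M)]_a' qval Q s a' = qval Q s a &
    forall a', qval Q s a' <= qval Q s a.
Proof.
set m := BIG_F.
pose a := [arg max_(a > action0 M) qval Q s a]%O.
have amax a' : qval Q s a' <= qval Q s a.
  by rewrite /a; case: arg_maxP => // b _; apply.
exists a => //; apply/eqP; rewrite eq_le; apply/andP; split.
  by apply: bigmax_le => //; exact: amax.
exact: le_bigmax.
Qed.

(** The difference of two maxima lies between the differences of the entries
    at the two maximizing actions: at a maximizer for [Q'] the difference is
    too small, at one for [Q] it is too large.  Hence it is an average of the
    two, and the averaging weights form a stochastic policy.  This makes the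
    nonlinear operator act on differences as a policy matrix depending on the
    two arguments. *)
Lemma bellman_sub (Q Q' : 'cV[R]_n) : exists2 mu, stochastic_policy mu &
  bellman M Q - bellman M Q' = policy_mx M mu *m (Q - Q').
Proof.
pose mx (Q : 'cV[R]_n) s := \big[Num.max/qval Q s (action0 M)]_a' qval Q s a'.
have hs s : exists p : A -> R, ((forall a, 0 <= p a) /\ \sum_a p a = 1) /\
    mx Q s - mx Q' s = \sum_a p a * qval (Q - Q') s a.
  have [a1 e1 m1] := max_attained Q s; have [a2 e2 m2] := max_attained Q' s.
  have qB a : qval (Q - Q') s a = qval Q s a - qval Q' s a by rewrite /qval !mxE.
  set u1 := qval (Q - Q') s a1; set u2 := qval (Q - Q') s a2.
  have : u2 <= mx Q s - mx Q' s <= u1.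
    by rewrite /mx e1 e2 /u1 /u2 !qB lerB ?m1 //= lerB // m2.
  set d := mx Q s - _ => /andP[d2 d1].
  have [t [t0 t1 dt]] : exists t, [/\ 0 <= t, t <= 1 & d = t * u1 + (1 - t) * u2].
    have [u12|u12] := eqVneq u1 u2.
      by exists 0; split => //; lra.
    have u21 : 0 < u1 - u2 by rewrite subr_gt0 lt_def u12 (le_trans d2 d1).
    exists ((d - u2) / (u1 - u2)); split.
    - by rewrite divr_ge0 ?subr_ge0 // ltW // -subr_gt0.
    - by rewrite ler_pdivrMr // mul1r lerB.
    - by field; rewrite gt_eqF.
  have pick b (f : A -> R) : \sum_a (a == b)%:R * f a = f b.
    rewrite (bigD1 b) //= big1 ?addr0 ?eqxx ?mul1r // => a /negbTE ->.
    by rewrite mul0r.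
  exists (fun a => t * (a == a1)%:R + (1 - t) * (a == a2)%:R); split; first split.
  - by move=> a; rewrite addr_ge0 ?mulr_ge0 ?subr_ge0 ?ler0n.
  - rewrite big_split /= -!mulr_sumr.
    have p1 (b : A) : \sum_a (a == b)%:R = 1 :> R.
      by rewrite -[RHS](pick b (fun=> 1)); apply: eq_bigr => a _; rewrite mulr1.
    by rewrite !p1; ring.
  - rewrite dt; under eq_bigr => a _ do rewrite mulrDl -!mulrA.
    by rewrite big_split /= -!mulr_sumr !pick.
have [mu hmu] := choice hs.
exists mu; first by move=> s; case: (hmu s).
apply/matrixP => i j; rewrite ord1 policy_mx_mulE !mxE.
case: (enum_val i) => s a /=; rewrite addrAC opprD addrA subrr add0r addrC.
rewrite -mulrBr -sumrB; congr (_ * _); apply: eq_bigr => s' _.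
by rewrite -mulrBr; case: (hmu s') => _ <-.
Qed.

Lemma Qstar_fixed : bellman M (Qstar M) = Qstar M.
Proof.
have : exists Q, bellman M Q = Q.
  apply: (@contraction_fixed_point _ _ _ gamma).
  - exact: ltW (discount_gt0 M).
  - exact: discount_lt1.
  move=> x y B xy; have [mu hmu ->] := bellman_sub x y.
  exact: policy_mx_bound.
exact: (@xgetPex _ 0 [set Q | bellman M Q = Q]).
Qed.

End PolicyMatrices.

(** * Linear images and finite sums of seminorms *)

Lemma convex_comb_image (R : realType) (V U : lmodType R) (L : V -> U)
    (H : set V) x : linear L ->
  convex_comb_of H x -> convex_comb_of (L @` H) (L x).
Proof.
move=> lL [I [w [g [w0 w1 gH ->]]]]; exists I, w, (L \o g); split => //=.
  by move=> i; exists (g i).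
pose f : {linear V -> U} := HB.pack L (GRing.isLinear.Build _ _ _ _ L lL).
rewrite -[L]/(f : _ -> _) linear_sum; apply: eq_bigr => i _.
by rewrite linearZ.
Qed.

Lemma seminorm_bigsum (R : realType) (V : lmodType R) (I : finType)
    (phi : I -> V -> R) : (forall i, seminorm (phi i)) ->
  seminorm (fun x => \sum_i phi i x).
Proof.
move=> sphi; split=> [x y|c x].
  by rewrite -big_split; apply: ler_sum => i _; case: (sphi i).
by rewrite mulr_sumr; apply: eq_bigr => i _; case: (sphi i) => _ ->.
Qed.

Lemma seminorm_comp (R : realType) (V U : lmodType R) (L : V -> U)
    (phi : U -> R) : linear L -> seminorm phi -> seminorm (phi \o L).
Proof.
move=> lL [hD hZ]; pose f : {linear V -> U} :=
  HB.pack L (GRing.isLinear.Build _ _ _ _ L lL).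
have LD x y : L (x + y) = L x + L y := linearD f x y.
have LZ c x : L (c *: x) = c *: L x := linearZ_LR f c x.
by split=> [x y|c x] /=; rewrite ?LD ?LZ.
Qed.

Lemma seminorm_norm (R : realType) : seminorm (fun x : R^o => `|x|).
Proof. by split=> [x y|c x]; [exact: ler_normD | exact: normrM]. Qed.

Lemma ler_sum_fin (R : realType) (I : finType) (F : I -> R) i :
  (forall j, 0 <= F j) -> F i <= \sum_j F j.
Proof. by move=> F0; rewrite (bigD1 i) //= lerDl sumr_ge0. Qed.

(** * Euclidean norm and entries *)

Section Norm2.
Variables (R : realType) (S A : finType).
Implicit Types x : 'cV[R]_(qdim S A).

Lemma norm2_ge0 x : 0 <= norm2 x. Proof. exact: sqrtr_ge0. Qed.

Lemma entry_le_norm2 x i : `|x i 0| <= norm2 x.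
Proof.
rewrite -sqrtr_sqr ler_wsqrtr //.
by apply: (ler_sum_fin (F := fun i => x i 0 ^+ 2)) => j; exact: sqr_ge0.
Qed.

Lemma norm2_le_sum x : norm2 x <= \sum_i `|x i 0|.
Proof.
have s0 : 0 <= \sum_i `|x i 0| by apply: sumr_ge0.
rewrite -[leRHS]ger0_norm // -sqrtr_sqr ler_wsqrtr //.
rewrite expr2 mulr_suml; apply: ler_sum => i _.
rewrite -real_normK ?num_real // expr2 ler_wpM2l //.
exact: (ler_sum_fin (F := fun i => `|x i 0|)).
Qed.

Lemma norm2_scale_ones (c : R) : 0 <= c ->
  norm2 (c *: ones R S A) = Num.sqrt (qdim S A)%:R * c.
Proof.
move=> c0; rewrite /norm2.
under eq_bigr => i _ do rewrite !mxE mulr1.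
rewrite sumr_const card_ord -(mulr_natl (c ^+ 2)) sqrtrM ?ler0n //.
by rewrite sqrtr_sqr ger0_norm.
Qed.

End Norm2.

(** * The projected family has rate at most the discount *)

Section Main.
Variables (R : realType) (S A : finType) (M : mdp R S A).
Local Notation n := (qdim S A).
Local Notation one := (ones R S A).
Local Notation Pi := (Pi_perp R S A).
Local Notation gamma := (discount M).
Local Notation W := (subvs_of (span1_perp R S A)).
Local Notation l := (n%:R * (1 - gamma))^-1.
Local Notation proj := (vsproj (span1_perp R S A)).

Variables (N : 'End(W) -> R) (hN : submul_norm N).
Let sN := submul_norm_seminorm hN.

Let pi0 : {ffun S -> A} := [ffun=> action0 M].

Lemma projected_nonempty : projected_family M !=set0.
Proof. by rewrite projected_familyE; exists (compress (det_mx M pi0)), pi0. Qed.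

Definition proj_bound := \sum_(pi : {ffun S -> A}) N (compress (det_mx M pi)).

Lemma projected_bounded f : projected_family M f -> N f <= proj_bound.
Proof.
rewrite projected_familyE => -[pi _ <-].
apply: (ler_sum_fin (F := fun pi => N (compress (det_mx M pi)))) => pi'.
exact: seminorm_ge0.
Qed.

Let growth_proj := jsr_growth_rate hN projected_nonempty projected_bounded.
Let rho := jsr N (projected_family M).

(** Since inner projections can be erased ([policy_mx_Pi]), a product of
    projected operators is the compression of the plain product of policy
    matrices, whose rows are nonnegative with sum [gamma ^+ k]. *)
Lemma projected_words_nonneg_mx k G : words (projected_family M) k G ->
  exists B : 'M[R]_n, [/\ forall i j, 0 <= B i j, B *m one = gamma ^+ k *: one
    & G = compress B].
Proof.
elim: k G => [|k IH] G /=.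
  move=> ->; exists 1%:M; split.
  - by move=> i j; rewrite mxE ler0n.
  - by rewrite mul1mx expr0 scale1r.
  - by apply/lfunP => w; rewrite compressE id_lfunE mul1mx Pi_vsval vsvalK.
case=> _ [pi _ <-] [G' /IH[B [B0 B1 ->]] <-].
have hpi := onehot_stochastic R pi.
exists (policy_mx M (onehot R pi) *m B); split.
- move=> i j; rewrite mxE; apply: sumr_ge0 => m _; rewrite mulr_ge0 //.
  exact: policy_mx_ge0.
- by rewrite -mulmxA B1 -scalemxAr policy_mx_ones // scalerA exprSr.
- apply/lfunP => w; rewrite projected_mapE comp_lfunE !compressE.
  by rewrite (vsval_vsproj_Pi (qdim_gt0 M)) policy_mx_Pi // -mulmxA.
Qed.

Lemma projected_words_le_discount : exists2 C, 0 < C &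
  forall k G, words (projected_family M) k G -> N G <= C * gamma ^+ k.
Proof.
pose C := \sum_i \sum_j N (compress (delta_mx i j)).
have C0 : 0 <= C.
  by apply: sumr_ge0 => i _; apply: sumr_ge0 => j _; exact: seminorm_ge0.
exists (1 + C); first by rewrite ltr_pwDl.
move=> k G /projected_words_nonneg_mx[B [B0 B1 ->]].
have g0 : 0 <= gamma ^+ k by rewrite exprn_ge0 // ltW // discount_gt0.
apply: (@le_trans _ _ (C * gamma ^+ k)); last by rewrite ler_wpM2r // lerDr.
have sc : seminorm (N \o @compress R S A).
  by apply: seminorm_comp => //; exact: compress_linear.
rewrite {1}(matrix_sum_delta B) mulr_suml.
apply: le_trans (seminorm_sum _ _ sc) _; apply: ler_sum => i _.
rewrite mulr_suml.
apply: le_trans (seminorm_sum _ _ sc) _; apply: ler_sum => j _.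
case: (sc) => _ -> /=; rewrite ger0_norm // mulrC ler_wpM2l ?seminorm_ge0 //.
have -> : gamma ^+ k = \sum_m B i m.
  have /matrixP /(_ i 0) := B1; rewrite !mxE mulr1 => <-.
  by apply: eq_bigr => m _; rewrite mxE mulr1.
exact: ler_sum_fin.
Qed.

Lemma jsr_projected_le_discount : rho <= gamma.
Proof.
have [C C0 hC] := projected_words_le_discount.
have g0 : 0 <= gamma := ltW (discount_gt0 M).
have c1 := growth_rate_cvg growth_proj.
have c2 := cvg_root_geometric C0 g0.
apply: (ler_cvg_to c1 c2); apply: nearW => k.
have w0 := word_norm_ge0 hN projected_nonempty projected_bounded k.
apply: ge0_ler_powR; rewrite ?invr_ge0 ?nnegrE //.
  by rewrite mulr_ge0 ?exprn_ge0 // ltW.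
by apply: word_norm_le => [|G]; [exact: projected_nonempty | exact: hC].
Qed.

(** * Equality of the two joint spectral radii *)

Definition stoch_projected : set 'End(W) :=
  [set compress (policy_mx M mu) | mu in @stochastic_policy R S A].

Lemma stoch_projected_convex f : stoch_projected f ->
  convex_comb_of (projected_family M) f.
Proof.
case=> mu hmu <-; rewrite projected_familyE -image_comp.
apply: convex_comb_image; first exact: compress_linear.
exact: policy_mx_convex.
Qed.

Section Augmented.
Variables (Naug : 'End((R^o * W)%type) -> R) (hNaug : submul_norm Naug).
Let sNaug := submul_norm_seminorm hNaug.

(** Every member of the augmented family is a convex combination of these
    finitely many, so it suffices to bound their products, and constants
    obtained for each of them separately are uniform. *)
Definition det_deflated : set 'End((R^o * W)%type) :=
  (augment l \o det_mx M) @` setT.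

Lemma deflated_convex f : deflated_family M f -> convex_comb_of det_deflated f.
Proof.
rewrite deflated_familyE => -[mu hmu <-]; rewrite /det_deflated -image_comp.
apply: convex_comb_image; first exact: augment_linear.
exact: policy_mx_convex.
Qed.

Lemma det_deflated_sub : det_deflated `<=` deflated_family M.
Proof.
rewrite deflated_familyE => _ [pi _ <-].
by exists (onehot R pi) => //; exact: onehot_stochastic.
Qed.

Lemma deflated_nonempty : deflated_family M !=set0.
Proof.
by exists (augment l (det_mx M pi0)); apply: det_deflated_sub; exists pi0.
Qed.

Definition aug_bound := \sum_(pi : {ffun S -> A}) Naug (augment l (det_mx M pi)).

Lemma deflated_bounded f : deflated_family M f -> Naug f <= aug_bound.
Proof.
move/deflated_convex; apply: seminorm_convex_comb => // _ [pi _ <-].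
apply: (ler_sum_fin (F := fun pi => Naug (augment l (det_mx M pi)))) => pi'.
exact: seminorm_ge0.
Qed.

(** The augmented operators are block triangular with zero first column, so
    their products act on the second component as the products of the diagonal
    blocks. *)
Lemma det_deflated_words_snd k g : words det_deflated k g ->
  exists2 G, words (projected_family M) k G & forall z, (g z).2 = G z.2.
Proof.
elim: k g => [|k IH] g /=.
  by move=> ->; exists \1%VF => // z; rewrite !id_lfunE.
case=> _ [pi _ <-] [g' /IH[G GH gG] <-].
exists (compress (det_mx M pi) \o G)%VF.
  exists (compress (det_mx M pi)); last by exists G.
  by rewrite projected_familyE; exists pi.
by move=> z; rewrite !comp_lfunE augmentE /= gG.
Qed.

Lemma projected_words_lift k G : words (projected_family M) k G ->
  exists2 g, words (deflated_family M) k g & forall z, (g z).2 = G z.2.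
Proof.
elim: k G => [|k IH] G /=.
  by move=> ->; exists \1%VF => // z; rewrite !id_lfunE.
rewrite {1}projected_familyE => -[_ [pi _ <-] [G' /IH[g gH gG] <-]].
exists (augment l (det_mx M pi) \o g)%VF.
  exists (augment l (det_mx M pi)); last by exists g.
  by apply: det_deflated_sub; exists pi.
by move=> z; rewrite !comp_lfunE augmentE /= gG.
Qed.

Definition snd_lfun : 'Hom((R^o * W)%type, W) :=
  linfun (fun z : (R^o * W)%type => z.2).
Definition inr_lfun : 'Hom(W, (R^o * W)%type) :=
  linfun (fun w : W => (0 : R^o, w)).

Lemma snd_lfunE z : snd_lfun z = z.2.
Proof. by apply: linfun_lamE. Qed.

Lemma inr_lfunE w : inr_lfun w = (0, w).
Proof.
apply: linfun_lamE => a u v; congr pair => /=.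
by rewrite scaler0 addr0.
Qed.

Lemma sandwich_linear (V1 V2 V3 V4 : vectType R)
    (f : 'Hom(V3, V4)) (g : 'Hom(V1, V2)) :
  linear (fun h : 'Hom(V2, V3) => (f \o (h \o g))%VF).
Proof.
move=> a x y.
by rewrite comp_lfunDl comp_lfunDr -comp_lfunZl -comp_lfunZr.
Qed.

(** A product [G] of projected operators is the lower right block of a product
    of augmented ones, and taking this block is a linear map. *)
Lemma projected_le_deflated : exists2 C, 0 < C & forall k,
  word_norm N (projected_family M) k <=
    C * word_norm Naug (deflated_family M) k.
Proof.
have sphi : seminorm (fun g : 'End((R^o * W)%type) =>
    N (snd_lfun \o (g \o inr_lfun))%VF).
  exact: (seminorm_comp (sandwich_linear snd_lfun inr_lfun) sN).
have [C C0 hC] := seminorm_le_submul_norm hNaug sphi.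
exists C => // k; apply: word_norm_le; first exact: projected_nonempty.
move=> G /projected_words_lift[g gH gG].
have -> : G = (snd_lfun \o (g \o inr_lfun))%VF.
  by apply/lfunP => w; rewrite !comp_lfunE snd_lfunE gG inr_lfunE.
apply: le_trans (hC g) _; rewrite ler_pM2l //.
exact: (word_norm_ge hNaug deflated_bounded).
Qed.

(** A product of [k.+1] augmented operators depends linearly on the product of
    its first [k] diagonal blocks: the leftmost factor ignores the first
    component of its argument, so the upper row is also a fixed linear
    functional of that product.  This costs the index shift. *)
Lemma deflated_le_projected : exists2 C, 0 < C & forall k,
  word_norm Naug (deflated_family M) k.+1 <=
    C * word_norm N (projected_family M) k.
Proof.
pose J pi := (augment l (det_mx M pi) \o inr_lfun)%VF.
pose phi (pi : {ffun S -> A}) (G : 'End(W)) := Naug (J pi \o (G \o snd_lfun))%VF.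
have sphi pi : seminorm (phi pi).
  exact: (seminorm_comp (sandwich_linear (J pi) snd_lfun) sNaug).
have [C C0 hC] := seminorm_le_submul_norm hN (seminorm_bigsum sphi).
exists C => // k; apply: word_norm_le; first exact: deflated_nonempty.
apply: (words_convex sNaug deflated_convex).
move=> _ /= [_ [pi _ <-] [g /det_deflated_words_snd[G GH gG] <-]].
have -> : (augment l (det_mx M pi) \o g)%VF = (J pi \o (G \o snd_lfun))%VF.
  apply/lfunP => z.
  by rewrite /J !comp_lfunE snd_lfunE inr_lfunE /= !augmentE /= gG.
apply: (@le_trans _ _ (C * N G)).
  apply: le_trans (hC G).
  apply: (ler_sum_fin (F := fun pi => phi pi G)) => pi'.
  exact: seminorm_ge0.
rewrite ler_pM2l //.
exact: (word_norm_ge hN projected_bounded).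
Qed.

(** The two families of word norms differ by constants and an index shift, which
    do not affect the exponential rate. *)
Lemma jsr_deflated_eq : jsr Naug (deflated_family M) = rho.
Proof.
apply: growth_rate_jsr; have [rho0 [c c0 lo] up] := growth_proj.
split => //.
  have [C C0 hC] := projected_le_deflated.
  exists (c / C); first by rewrite divr_gt0.
  move=> k k0; rewrite mulrAC ler_pdivrMr // [leRHS]mulrC.
  exact: le_trans (lo k k0) (hC k).
move=> beta rb; have [C1 C10 h1] := up beta rb.
have b0 : 0 < beta by apply: le_lt_trans rb.
have [C2 C20 h2] := deflated_le_projected.
have K0 := word_norm_ge0 hNaug deflated_nonempty deflated_bounded 0.
exists (C2 * C1 / beta + word_norm Naug (deflated_family M) 0).
  by rewrite ltr_pwDl // divr_gt0 // mulr_gt0.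
(* The shifted bound says nothing at length 0, whence the second summand of
   the constant. *)
case=> [|k].
  by rewrite expr0 mulr1 lerDr divr_ge0 ?mulr_ge0 // ltW.
apply: le_trans (h2 k) _.
apply: (@le_trans _ _ (C2 * C1 / beta * beta ^+ k.+1)).
  by rewrite exprS mulrA divfK ?gt_eqF // -mulrA ler_pM2l.
by rewrite ler_pM2r ?exprn_gt0 // lerDl.
Qed.

End Augmented.


(** * Trajectories *)

Lemma mean_scale_ones (c : R) : mean (c *: one) = c.
Proof.
rewrite /mean -scalemxAr ones_sqr scale_scalar_mx mxE eqxx mulr1n mulrCA.
by rewrite mulVf ?mulr1 // (qdim_neq0 _ (qdim_gt0 M)).
Qed.

Lemma meanD (x y : 'cV[R]_n) : mean (x + y) = mean x + mean y.
Proof. by rewrite /mean mulmxDr mxE mulrDr. Qed.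

Lemma meanZ c (x : 'cV[R]_n) : mean (c *: x) = c * mean x.
Proof. by rewrite /mean -scalemxAr mxE mulrCA. Qed.

(** The error after one deflated step when [x] is the mean-zero part of the
    error before it and the Bellman operator acts on that error as [X]. *)
Definition step (X : 'M[R]_n) (x : 'cV[R]_n) : 'cV[R]_n :=
  X *m x + (gamma / (1 - gamma) * mean (X *m x)) *: one.

Lemma step_linearl x : linear (step^~ x).
Proof.
move=> a X Y; rewrite /step mulmxDl -scalemxAl meanD meanZ.
by rewrite mulrDr mulrCA scalerDl scalerDr scalerA addrACA.
Qed.

Lemma step_linearr X : linear (step X).
Proof.
move=> a x y; rewrite /step mulmxDr -scalemxAr meanD meanZ.
by rewrite mulrDr mulrCA scalerDl scalerDr scalerA addrACA.
Qed.

Lemma discount_neq1 : 1 - gamma != 0.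
Proof. by rewrite subr_eq0 gt_eqF // discount_lt1. Qed.

(** The correction is tuned to forget the mean of the error: a component
    [c *: one] becomes [gamma * c] under the Bellman operator, and contributes
    [gamma / (1 - gamma) * (gamma * c - c) = - gamma * c] to the correction. *)
Lemma deflated_error (Q : nat -> 'cV[R]_n) k : deflated_qvi M Q ->
  exists2 mu, stochastic_policy mu &
    Q k.+1 - Qstar M = step (policy_mx M mu) (Pi *m (Q k - Qstar M)).
Proof.
move=> hQ; have [mu hmu hd] := bellman_sub M (Q k) (Qstar M).
exists mu => //; set e := Q k - Qstar M in hd *; set X := policy_mx M mu in hd *.
have bQ : bellman M (Q k) = X *m e + Qstar M by rewrite -hd Qstar_fixed subrK.
have eE := mean_Pi (qdim_gt0 M) e.
have Xe : X *m e = (gamma * mean e) *: one + X *m (Pi *m e).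
  by rewrite {1}eE mulmxDr -scalemxAr policy_mx_ones // scalerA mulrC.
have be : bellman M (Q k) - Q k = X *m e + (-1) *: e.
  by rewrite bQ /e scaleN1r opprB addrA.
rewrite hQ be bQ addrAC addrK; clearbody e X.
rewrite meanD meanZ Xe /step meanD mean_scale_ones.
set m := mean e; set p := mean (X *m (Pi *m e)).
rewrite addrAC -scalerDl addrC; congr (_ + _ *: _).
by field; exact: discount_neq1.
Qed.

Lemma deflated_error_word (Q : nat -> 'cV[R]_n) k : deflated_qvi M Q ->
  exists2 G, words stoch_projected k G &
    Pi *m (Q k - Qstar M) = vsval (G (proj (Pi *m (Q 0%N - Qstar M)))).
Proof.
move=> hQ; elim: k => [|k [G GH GE]].
  by exists \1%VF => //; rewrite id_lfunE (vsval_vsproj_Pi (qdim_gt0 M)).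
have [mu hmu ->] := deflated_error k hQ.
exists (compress (policy_mx M mu) \o G)%VF.
  by exists (compress (policy_mx M mu)); [exists mu | exists G].
rewrite comp_lfunE compressE (vsval_vsproj_Pi (qdim_gt0 M)) -GE /step.
rewrite mulmxDr -[Pi *m (_ *: _)]scalemxAr (Pi_ones _ (qdim_gt0 M)).
by rewrite scaler0 addr0.
Qed.

(** A bound for the operator [y |-> step X (G y)] that is a seminorm in [X] and
    in [G] separately, so that both stochastic policies and words of them can be
    reduced to deterministic ones. *)
Definition traj_size (X : 'M[R]_n) (G : 'End(W)) : R :=
  \sum_j \sum_i `|step X (vsval (G (proj (delta_mx j 0)))) i 0|.

Lemma entry_linear (V : lmodType R) (f : V -> 'cV[R]_n) i :
  linear f -> linear (fun x => f x i 0 : R^o).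
Proof. by move=> lf a x y; rewrite lf !mxE. Qed.

Lemma traj_size_seminorml G : seminorm (traj_size^~ G).
Proof.
apply: seminorm_bigsum => j; apply: seminorm_bigsum => i.
apply: (seminorm_comp (phi := fun x : R^o => `|x|)); last exact: seminorm_norm.
by apply: entry_linear; exact: step_linearl.
Qed.

Lemma traj_size_seminormr X : seminorm (traj_size X).
Proof.
apply: seminorm_bigsum => j; apply: seminorm_bigsum => i.
apply: (seminorm_comp (phi := fun x : R^o => `|x|)); last exact: seminorm_norm.
apply: entry_linear => a G G'.
by rewrite add_lfunE scale_lfunE linearP step_linearr.
Qed.

Lemma norm2_step_le X (G : 'End(W)) (y : 'cV[R]_n) :
  norm2 (step X (vsval (G (proj y)))) <= traj_size X G * norm2 y.
Proof.
pose f x := step X (vsval (G (proj x))).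
have lf : linear f by move=> a u v; rewrite /f !linearP step_linearr.
pose F : {linear 'cV[R]_n -> 'cV[R]_n} :=
  HB.pack f (GRing.isLinear.Build _ _ _ _ f lf).
have yE : y = \sum_j y j 0 *: delta_mx j 0.
  by rewrite {1}(matrix_sum_delta y); apply: eq_bigr => j _; rewrite big_ord1.
apply: le_trans (norm2_le_sum _) _.
rewrite /traj_size exchange_big /= mulr_suml; apply: ler_sum => i _.
rewrite {1}yE -[step X _]/(F _) linear_sum summxE.
apply: le_trans (ler_norm_sum _ _ _) _; rewrite mulr_suml; apply: ler_sum => j _.
rewrite linearZ mxE normrM mulrC ler_wpM2l //.
exact: entry_le_norm2.
Qed.

(** The error at time [k.+1] is one [step] applied to a word of length [k]; the
    first reduction handles the policy of that step, the second one those of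
    the word. *)
Lemma deflated_trajectory_bound : exists2 C, 0 < C &
  forall Q, deflated_qvi M Q -> forall k,
    norm2 (Q k.+1 - Qstar M) <=
      C * word_norm N (projected_family M) k * norm2 (Pi *m (Q 0%N - Qstar M)).
Proof.
have ssum : seminorm
    (fun G => \sum_(pi : {ffun S -> A}) traj_size (det_mx M pi) G).
  by apply: seminorm_bigsum => pi; exact: traj_size_seminormr.
have [C C0 hC] := seminorm_le_submul_norm hN ssum.
exists C => // Q hQ k; have [mu hmu ->] := deflated_error k hQ.
have [G GH ->] := deflated_error_word k hQ.
apply: le_trans (norm2_step_le _ _ _) _; apply: ler_wpM2r; first exact: norm2_ge0.
apply: (@le_trans _ _ (C * N G)).
  apply: (seminorm_convex_comb (traj_size_seminorml G) _ (policy_mx_convex M hmu)).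
  move=> _ [pi _ <-]; apply: le_trans (hC G).
  apply: (ler_sum_fin (F := fun pi => traj_size (det_mx M pi) G)) => pi'.
  exact: seminorm_ge0 (traj_size_seminormr _).
rewrite ler_pM2l //; apply: (words_convex sN stoch_projected_convex _ GH) => G'.
exact: (word_norm_ge hN projected_bounded).
Qed.

Lemma deflated_convergence beta : rho < beta -> exists2 C, 0 < C &
  forall Q, deflated_qvi M Q -> forall k, (1 <= k)%N ->
    norm2 (Q k - Qstar M) <=
      C * beta ^+ (k - 1) * norm2 (Pi *m (Q 0%N - Qstar M)).
Proof.
move=> rb; have [_ _ /(_ _ rb)[C1 C10 h1]] := growth_proj.
have [C C0 hC] := deflated_trajectory_bound.
exists (C * C1); first exact: mulr_gt0.
move=> Q hQ [//|k] _; apply: le_trans (hC Q hQ k) _.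
apply: ler_wpM2r; first exact: norm2_ge0.
by rewrite subn1 -mulrA ler_pM2l.
Qed.

Lemma deflated_error_rate (Q : nat -> 'cV[R]_n) : deflated_qvi M Q ->
  (error_rate M Q <= rho%:E)%E.
Proof.
move=> hQ; apply/lee_addgt0Pr => e e0.
have re : rho < rho + e by rewrite ltrDl.
have [rho0 _ _] := growth_proj.
have be0 : 0 < rho + e by apply: le_lt_trans re.
have [C C0 hC] := deflated_convergence re.
rewrite -EFinD; set d := norm2 (Pi *m (Q 0%N - Qstar M)) in hC.
apply: (@limn_esup_root_le _ _ (C * d / (rho + e))); first exact: ltW.
  by move=> k; exact: norm2_ge0.
case=> // k _; apply: le_trans (hC Q hQ k.+1 isT) _; rewrite subn1 /= -/d.
by rewrite exprS mulrA divfK ?gt_eqF // mulrAC.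
Qed.

Lemma qvi_error_rate_le (Q : nat -> 'cV[R]_n) : qvi M Q ->
  (error_rate M Q <= gamma%:E)%E.
Proof.
move=> hQ; have g0 : 0 <= gamma := ltW (discount_gt0 M).
have bound k i : `|(Q k - Qstar M) i 0| <= gamma ^+ k * norm2 (Q 0%N - Qstar M).
  elim: k i => [|k IH] i; first by rewrite expr0 mul1r entry_le_norm2.
  have [mu hmu] := bellman_sub M (Q k) (Qstar M).
  rewrite Qstar_fixed hQ => ->; rewrite exprS -mulrA.
  exact: policy_mx_bound.
apply: (@limn_esup_root_le _ _ (n%:R * norm2 (Q 0%N - Qstar M))) => //.
  by move=> k; exact: norm2_ge0.
move=> k _; apply: le_trans (norm2_le_sum _) _.
have -> : n%:R * norm2 (Q 0%N - Qstar M) * gamma ^+ k =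
    \sum_(i < n) gamma ^+ k * norm2 (Q 0%N - Qstar M).
  by rewrite sumr_const card_ord -[RHS]mulr_natl -mulrA (mulrC (gamma ^+ k)).
by apply: ler_sum => i _; exact: bound.
Qed.

(** The worst case is attained when the initial error is [one], an eigenvector
    of every policy matrix for the eigenvalue [gamma]. *)
Lemma qvi_error_rate_ones :
  error_rate M (fun k => iter k (bellman M) (Qstar M + one)) = gamma%:E.
Proof.
have g0 : 0 <= gamma := ltW (discount_gt0 M).
have err k : iter k (bellman M) (Qstar M + one) - Qstar M = gamma ^+ k *: one.
  elim: k => [|k IH]; first by rewrite expr0 scale1r /= addrC addKr.
  have [mu hmu] := bellman_sub M (iter k (bellman M) (Qstar M + one)) (Qstar M).
  rewrite Qstar_fixed iterS => ->.
  by rewrite IH -scalemxAr policy_mx_ones // scalerA exprSr.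
rewrite /error_rate; under eq_fun => k do
  rewrite err (norm2_scale_ones _ _ (exprn_ge0 k g0)).
have sn0 : 0 < Num.sqrt n%:R :> R by rewrite sqrtr_gt0 ltr0n (qdim_gt0 M).
have c := cvg_root_geometric sn0 g0.
refine (cvg_limn_einf_sup _).2.
by apply: cvg_EFin c; exact: nearW.
Qed.

Lemma qvi_worst_error_rate :
  ereal_sup [set error_rate M Q | Q in [set Q | qvi M Q]] = gamma%:E.
Proof.
apply/eqP; rewrite eq_le; apply/andP; split.
  by apply: ge_ereal_sup => _ [Q hQ <-]; exact: qvi_error_rate_le.
apply: ereal_sup_ubound; rewrite -qvi_error_rate_ones.
by exists (fun k => iter k (bellman M) (Qstar M + one)).
Qed.

End Main.

Theorem theorem1 (R : realType) (S A : finType) (M : mdp R S A)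
    (N : 'End(subvs_of (span1_perp R S A)) -> R)
    (Naug : 'End((R^o * subvs_of (span1_perp R S A))%type) -> R)
    (hN : submul_norm N) (hNaug : submul_norm Naug) :
  let gamma := discount M in
  let rho_bar := jsr N (projected_family M) in
  let rho_def := jsr Naug (deflated_family M) in
  [/\ rho_def = rho_bar,
      forall eps : R, 0 < eps -> eps < 1 - rho_bar ->
        exists2 C : R, 0 < C &
          forall Q : nat -> 'cV[R]_(qdim S A), deflated_qvi M Q ->
          forall k : nat, (1 <= k)%N ->
            norm2 (Q k - Qstar M) <=
              C * (rho_bar + eps) ^+ (k - 1)
                * norm2 (Pi_perp R S A *m (Q 0%N - Qstar M)),
      forall Q : nat -> 'cV[R]_(qdim S A), deflated_qvi M Q ->
        (error_rate M Q <= rho_bar%:E)%E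
    & [/\ rho_bar <= gamma,
          rho_def <= gamma,
          ereal_sup [set error_rate M Q | Q in [set Q | qvi M Q]] = gamma%:E
        & rho_bar < gamma -> rho_def < gamma]].
Proof.
move=> gamma rho_bar rho_def.
have eq_rho : rho_def = rho_bar by exact: jsr_deflated_eq.
split.
- exact: eq_rho.
- move=> eps eps0 _; apply: (deflated_convergence hN).
  by rewrite ltrDl.
- move=> Q hQ; exact: (deflated_error_rate hN hQ).
- rewrite eq_rho; split.
  + exact: (jsr_projected_le_discount M hN).
  + exact: (jsr_projected_le_discount M hN).
  + exact: qvi_worst_error_rate.
  + by [].
Qed.
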